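(* Let $e$ be an interior edge between elements $\Omega_n$ and $\Omega_{n+1}$ with Jacobians $J_n$ and $J_{n+1}$, and let $p\ge 1$ be the polynomial degree. The BR2 scheme with penalty parameter $s$ is equivalent to the IP scheme with penalty parameter $\tau$ (i.e. the numerical fluxes at $e$ coincide for every discrete solution $u$) if and only if $$s=\frac{8J_nJ_{n+1}}{(J_n+J_{n+1})(p+1)^2}\,\tau .$$
   Context: The interval $\Omega$ is partitioned into elements $\Omega_n=[x_n,x_{n+1}]$, with $J_n=(x_{n+1}-x_n)/2$. A discrete solution $u$ is a (possibly discontinuous) piecewise polynomial of degree $\le p$ on the mesh; $\nabla u$ is its elementwise derivative in $x$. At an edge $e$, $v_{e,-}$, $v_{e,+}$ are the traces of $v$ from the left and right element; $[\![v_e]\!]=v_{e,-}-v_{e,+}$, $\{\{v_e\}\}=\frac12(v_{e,-}+v_{e,+})$. IP fluxes at $e$: $u^*=\{\{u\}\}$, $q^*=\{\{\nabla u\}\}-\tau[\![u]\!]$. BR2 fluxes at $e$: $u^*=\{\{u\}\}$, $q^*=\{\{\nabla u\}\}+s\{\{r^e([\![u]\!])\}\}$, where the lifting operator $r^e([\![u]\!])$ is the piecewise polynomial of degree $\le p$ on the mesh satisfying $\int_\Omega r^e([\![u]\!])\phi\,dx=-[\![u_e]\!]\{\{\phi_e\}\}$ for all piecewise polynomials $\phi$ of degree $\le p$. *)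

(* Defs.v *)
From mathcomp Require Import all_boot all_order all_algebra.
From mathcomp Require Import all_classical all_reals all_analysis.

Set Implicit Arguments.
Unset Strict Implicit.
Unset Printing Implicit Defensive.

Import Order.TTheory GRing.Theory Num.Theory.
Local Open Scope classical_set_scope.
Local Open Scope ring_scope.

(* A mesh with N.+1 elements has nodes x : 'I_N.+2 -> R, elements indexed by
   'I_N.+1 and interior edges indexed by 'I_N.  In each case [lo] and [hi] send
   an index to the same index, resp. its successor, in the next larger type:
   element k is [x (lo k), x (hi k)], and interior edge e lies between elements
   [lo e] and [hi e]. *)
Definition lo (n : nat) (i : 'I_n) : 'I_n.+1 := widen_ord (leqnSn n) i.
Definition hi (n : nat) (i : 'I_n) : 'I_n.+1 := lift ord0 i.

Definition is_mesh (R : realType) (N : nat) (x : 'I_N.+2 -> R) : Prop :=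
  forall i j : 'I_N.+2, (i < j)%N -> x i < x j.

Definition mesh_domain (R : realType) (N : nat) (x : 'I_N.+2 -> R) : set R :=
  `[x ord0, x ord_max].

Definition elt_jacobian (R : realType) (N : nat) (x : 'I_N.+2 -> R)
    (k : 'I_N.+1) : R :=
  (x (hi k) - x (lo k)) / 2.

(* One polynomial in the physical variable per element, so that functions are
   double-valued at interior nodes. *)
Definition broken (R : realType) (N : nat) : Type := 'I_N.+1 -> {poly R}.

Definition broken_degree_le (R : realType) (N p : nat) (v : broken R N) : Prop :=
  forall k, (size (v k) <= p.+1)%N.

(* The values given to v at the nodes are immaterial for integration. *)
Definition broken_fun (R : realType) (N : nat) (x : 'I_N.+2 -> R)
    (v : broken R N) (t : R) : R :=
  \sum_(k < N.+1) if x (lo k) <= t < x (hi k) then (v k).[t] else 0.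

Definition broken_grad (R : realType) (N : nat) (v : broken R N) : broken R N :=
  fun k => (v k)^`().

Definition edge_point (R : realType) (N : nat) (x : 'I_N.+2 -> R) (e : 'I_N) : R :=
  x (hi (lo e)).

Definition trace_minus (R : realType) (N : nat) (x : 'I_N.+2 -> R) (e : 'I_N)
    (v : broken R N) : R :=
  (v (lo e)).[edge_point x e].

Definition trace_plus (R : realType) (N : nat) (x : 'I_N.+2 -> R) (e : 'I_N)
    (v : broken R N) : R :=
  (v (hi e)).[edge_point x e].

Definition edge_jump (R : realType) (N : nat) (x : 'I_N.+2 -> R) (e : 'I_N)
    (v : broken R N) : R :=
  trace_minus x e v - trace_plus x e v.

Definition edge_avg (R : realType) (N : nat) (x : 'I_N.+2 -> R) (e : 'I_N)
    (v : broken R N) : R :=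
  (trace_minus x e v + trace_plus x e v) / 2.

Definition is_lifting (R : realType) (N : nat) (x : 'I_N.+2 -> R) (p : nat)
    (e : 'I_N) (j : R) (r : broken R N) : Prop :=
  broken_degree_le p r /\
  forall phi : broken R N, broken_degree_le p phi ->
    \int[lebesgue_measure]_(t in mesh_domain x)
      (broken_fun x r t * broken_fun x phi t) = - j * edge_avg x e phi.

(* The element satisfying [is_lifting], picked by classical choice; the default
   value 0 is irrelevant since on a mesh such an element exists (uniquely). *)
Definition lifting (R : realType) (N : nat) (x : 'I_N.+2 -> R) (p : nat)
    (e : 'I_N) (j : R) : broken R N :=
  xget (fun=> 0) [set r : 'I_N.+1 -> {poly R} | is_lifting x p e j r].

(* Numerical fluxes as pairs (u^*, q^* ). *)
Definition IP_flux (R : realType) (N : nat) (x : 'I_N.+2 -> R) (e : 'I_N)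
    (tau : R) (u : broken R N) : R * R :=
  (edge_avg x e u, edge_avg x e (broken_grad u) - tau * edge_jump x e u).

Definition BR2_flux (R : realType) (N : nat) (x : 'I_N.+2 -> R) (p : nat)
    (e : 'I_N) (s : R) (u : broken R N) : R * R :=
  (edge_avg x e u, edge_avg x e (broken_grad u) + s * edge_avg x e (lifting x p e (edge_jump x e u))).

(* Main.v *)
(** On an interval [[a, b]] let [W = (t - a)^(p+1) (t - b)^p].  Repeated integration
    by parts shows that the [(p+1)]-st derivative of [W], divided by
    [p! (b - a)^(p+1)], represents evaluation at [b] on polynomials of degree at
    most [p]; its own value at [b] is [(p + 1)^2 / (b - a)].  The lifting of a jump
    [j] is therefore explicit on the two elements adjacent to the edge, and its
    average there is [- j (p + 1)^2 (J + J') / (8 J J')].  Comparing the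
    coefficients of the jump in the two fluxes gives the theorem, a unit jump being
    attained by the indicator function of the left element. *)

Require Import Defs.
From mathcomp Require Import all_boot all_order all_algebra.
From mathcomp Require Import all_classical all_reals all_analysis.
From mathcomp Require Import ring.

Set Implicit Arguments.
Unset Strict Implicit.

Import Order.TTheory GRing.Theory Num.Theory.
Import numFieldNormedType.Exports.
Local Open Scope classical_set_scope.
Local Open Scope ring_scope.

(** * Endpoint derivatives of the node polynomial *)

(** Derivation commutes with translation, so derivatives at [b] are read off the Taylor coefficients
    there. *)
Lemma derivn_horner (R : comNzRingType) (P : {poly R}) (n : nat) (b : R) :
  (P^`(n)).[b] = (P \Po ('X + b%:P))`_n *+ n`!.
Proof.
have shift m : P^`(m) \Po ('X + b%:P) = (P \Po ('X + b%:P))^`(m).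
  elim: m => [//|m IHm].
  by rewrite !derivnS -IHm deriv_comp derivD derivX derivC addr0 mulr1.
have := coef_derivn n (P \Po ('X + b%:P)) 0.
rewrite addn0 ffactnn => <-.
by rewrite -shift -horner_coef0 horner_comp !hornerE.
Qed.

(* Its [p]-th derivative is, up to scaling, the Radau polynomial vanishing at [a]. *)
Definition radau_node_poly (R : comNzRingType) (p : nat) (a b : R) : {poly R} :=
  ('X - a%:P) ^+ p.+1 * ('X - b%:P) ^+ p.

Section RadauNode.
Context (R : comNzRingType) (p : nat) (a b : R).
Let W : {poly R} := radau_node_poly p a b.

Lemma size_radau_node_poly : (size W <= (p + p.+1).+1)%N.
Proof.
rewrite (leq_trans (size_polyMleq _ _))//.
have sz n (c : R) : (size (('X - c%:P) ^+ n) <= n.+1)%N.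
  by rewrite (leq_trans (size_poly_exp_leq _ _))// size_XsubC mul1n.
by rewrite -subn1 leq_subLR (leq_trans (leq_add (sz p.+1 a) (sz p b)))// addnC.
Qed.

Lemma radau_node_poly_derivn_left (n : nat) : (n <= p)%N -> W^`(n).[a] = 0.
Proof.
move=> np; rewrite derivn_horner /W /radau_node_poly rmorphM !rmorphXn /= !rmorphB /=.
by rewrite !comp_polyX !comp_polyC addrK coefXnM ltnS np mul0rn.
Qed.

(** With [b] moved to the origin, the factor ['X ^+ p] turns the coefficients of index [p] and
    [p.+1] into the first two of a power of a binomial. *)
Lemma radau_node_poly_shift_right :
  W \Po ('X + b%:P) = ('X + (b - a)%:P) ^+ p.+1 * 'X ^+ p.
Proof.
rewrite /W /radau_node_poly rmorphM !rmorphXn /= !rmorphB /=.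
by rewrite !comp_polyX !comp_polyC addrK -addrA -polyCB.
Qed.

Lemma radau_node_poly_derivn_right (n : nat) : (n < p)%N -> W^`(n).[b] = 0.
Proof.
by move=> np; rewrite derivn_horner radau_node_poly_shift_right coefMXn np mul0rn.
Qed.

Lemma radau_node_poly_derivnp_right :
  W^`(p).[b] = p`!%:R * (b - a) ^+ p.+1.
Proof.
rewrite derivn_horner radau_node_poly_shift_right coefMXn ltnn subnn.
by rewrite -horner_coef0 !hornerE mulr_natl.
Qed.

Lemma radau_node_poly_derivnSp_right :
  W^`(p.+1).[b] = p.+1`!%:R * (p.+1%:R * (b - a) ^+ p).
Proof.
rewrite derivn_horner radau_node_poly_shift_right coefMXn ltnNge leqnSn subSnn.
set Q := _ ^+ _; have -> : Q`_1 = Q^`()`_0 by rewrite coef_deriv mulr1n.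
rewrite -horner_coef0 /Q deriv_exp derivD derivX derivC addr0 mul1r.
by rewrite hornerMn !hornerE /= -mulrA !mulr_natl.
Qed.

End RadauNode.

(** * Endpoint evaluation as integration against a polynomial kernel *)

(* The antiderivative of [W^`(p.+1) * phi] obtained by repeated integration by
   parts, exact because [phi^`(p.+1) = 0]. *)
Definition parts_primitive (R : comNzRingType) (p : nat) (W phi : {poly R}) : {poly R} :=
  \sum_(i < p.+1) (-1) ^+ i *: (W^`(p - i) * phi^`(i)).

Lemma deriv_parts_primitive (R : comNzRingType) (p : nat) (W phi : {poly R}) :
  (size phi <= p.+1)%N -> (parts_primitive p W phi)^`() = W^`(p.+1) * phi.
Proof.
move=> sphi; rewrite /parts_primitive raddf_sum /=.
pose T i := (-1) ^+ i *: (W^`(p.+1 - i) * phi^`(i)).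
have step (i : 'I_p.+1) :
    ((-1) ^+ i *: (W^`(p - i) * phi^`(i)))^`() = T i - T i.+1.
  rewrite derivZ derivM -!derivnS scalerDr -subSn ?leq_ord//.
  by rewrite /T subSS exprS mulN1r scaleNr opprK.
rewrite (eq_bigr _ (fun i _ => step i)) -(big_mkord xpredT (fun i => T i - T i.+1)).
under eq_bigr do rewrite -opprB.
rewrite sumrN telescope_sumr// opprB /T (derivn_poly0 sphi) mulr0 scaler0 subr0.
by rewrite subn0 expr0 scale1r.
Qed.

(** The Riesz representer of evaluation at [b] for the oriented integral from [a] to [b]; the
    normalising factor is the [p]-th derivative of the node polynomial at [b]. *)
Definition endpoint_kernel (R : fieldType) (p : nat) (a b : R) : {poly R} :=
  (p`!%:R * (b - a) ^+ p.+1)^-1 *: (radau_node_poly p a b)^`(p.+1).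

Lemma size_endpoint_kernel (R : fieldType) (p : nat) (a b : R) :
  (size (endpoint_kernel p a b) <= p.+1)%N.
Proof.
rewrite (leq_trans (size_scale_leq _ _))//.
apply/leq_sizeP => j pj; rewrite coef_derivn nth_default ?mul0rn//.
rewrite (leq_trans (size_radau_node_poly _ _ _))//.
by rewrite -addSn leq_add2l.
Qed.

Section EndpointKernel.
Context (R : numFieldType) (p : nat) (a b : R).
Hypothesis ab : a != b.

Let scale_neq0 : p`!%:R * (b - a) ^+ p.+1 != 0.
Proof.
by rewrite mulf_neq0 ?pnatr_eq0 -?lt0n ?fact_gt0// expf_neq0// subr_eq0 eq_sym.
Qed.

Lemma endpoint_kernel_diag :
  (endpoint_kernel p a b).[b] = p.+1%:R ^+ 2 / (b - a).
Proof.
have ba : b - a != 0 by rewrite subr_eq0 eq_sym.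
have pf : (p`!%:R : R) != 0 by rewrite pnatr_eq0 -lt0n fact_gt0.
rewrite hornerZ radau_node_poly_derivnSp_right factS natrM exprS.
by field; rewrite ba pf expf_neq0.
Qed.

(** Phrasing the integral through a primitive keeps the result algebraic and valid for either order
    of [a] and [b]. *)
Lemma endpoint_kernel_reproduces (phi : {poly R}) : (size phi <= p.+1)%N ->
  exists2 F : {poly R}, F^`() = endpoint_kernel p a b * phi &
    F.[b] - F.[a] = phi.[b].
Proof.
move=> sphi; pose W := radau_node_poly p a b.
exists ((p`!%:R * (b - a) ^+ p.+1)^-1 *: parts_primitive p W phi).
  by rewrite derivZ deriv_parts_primitive// scalerAl.
have Fa : (parts_primitive p W phi).[a] = 0.
  rewrite horner_sum big1// => i _.
  by rewrite hornerZ hornerM radau_node_poly_derivn_left ?leq_subr// mul0r mulr0.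
(* At [b] only the undifferentiated [phi] term survives: the others carry derivatives of [W] of
   order below [p]. *)
have Fb : (parts_primitive p W phi).[b] = p`!%:R * (b - a) ^+ p.+1 * phi.[b].
  rewrite horner_sum big_ord_recl big1 ?addr0 => [|i _].
    by rewrite expr0 scale1r subn0 hornerM radau_node_poly_derivnp_right.
  rewrite hornerZ hornerM radau_node_poly_derivn_right ?mul0r ?mulr0//.
  (* If [p] is 0, there is no index [i] left to treat. *)
  by rewrite ltn_subrL /=; case: (p) i => [[]|].
by rewrite !hornerZ Fa Fb mulr0 subr0 mulKf.
Qed.

End EndpointKernel.

(** * Integration of broken polynomials over the mesh *)

Lemma mesh_le (R : realType) (N : nat) (x : 'I_N.+2 -> R) (i j : 'I_N.+2) :
  is_mesh x -> (i <= j)%N -> x i <= x j.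
Proof. by move=> hx; rewrite leq_eqVlt => /orP[/eqP/val_inj->//|/hx/ltW]. Qed.

Section BrokenIntegral.
Context (R : realType).
Let mu := @lebesgue_measure R.

Lemma integrable_horner (a b : R) (P : {poly R}) :
  mu.-integrable `[a, b] (EFin \o horner P).
Proof.
apply: continuous_compact_integrable; first exact: segment_compact.
by apply: continuous_subspaceT => t; exact: continuous_horner.
Qed.

Lemma integral_horner_deriv (a b : R) (F : {poly R}) : a < b ->
  (\int[mu]_(t in `[a, b]) (F^`().[t])%:E = (F.[b] - F.[a])%:E)%E.
Proof.
move=> ab; rewrite EFinB (@continuous_FTC2 _ _ (horner F))//.
- by apply: continuous_subspaceT => t; exact: continuous_horner.
- split.
  + by move=> t _; exact: derivable_horner.
  + by apply: cvg_at_right_filter; exact: continuous_horner.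
  + by apply: cvg_at_left_filter; exact: continuous_horner.
- by move=> t _; rewrite -[LHS]/((horner F)^`()%classic t) -derive.derivE.
Qed.

(** The half-open elements are disjoint, so at most one summand of each factor is nonzero at [t] and
    no cross terms arise. *)
Lemma broken_funM (N : nat) (x : 'I_N.+2 -> R) (v w : broken R N) (t : R) :
  is_mesh x ->
  broken_fun x v t * broken_fun x w t = broken_fun x (fun k => v k * w k) t.
Proof.
move=> hx; rewrite /broken_fun.
have [[k tk]|none] := pselect (exists k : 'I_N.+1, x (lo k) <= t < x (hi k)); last first.
  have out k : (x (lo k) <= t < x (hi k)) = false.
    by apply/negP => tk; apply: none; exists k.
  rewrite [X in X * _]big1 ?mul0r ?big1// => k _; by rewrite out.
have uniqk j : j != k -> (x (lo j) <= t < x (hi j)) = false.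
  move=> jk; apply/negP => /andP[jt tj]; case/andP: tk => kt tk.
  have [jk'|kj|/val_inj jk'] := ltngtP j k; last by rewrite jk' eqxx in jk.
  - suff : x (hi j) <= t by rewrite leNgt tj.
    by apply: le_trans kt; exact: mesh_le hx _.
  - suff : x (hi k) <= t by rewrite leNgt tk.
    by apply: le_trans jt; exact: mesh_le hx _.
have only (f : 'I_N.+1 -> {poly R}) :
    \sum_(j < N.+1) (if x (lo j) <= t < x (hi j) then (f j).[t] else 0) = (f k).[t].
  by rewrite (bigD1 k)//= tk big1 ?addr0// => j /uniqk->.
by rewrite !only hornerM.
Qed.

Lemma integral_broken_fun (N : nat) (x : 'I_N.+2 -> R) (F : broken R N) :
  is_mesh x ->
  \int[mu]_(t in mesh_domain x) broken_fun x (broken_grad F) t =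
  \sum_(k < N.+1) ((F k).[x (hi k)] - (F k).[x (lo k)]).
Proof.
move=> hx; rewrite /Rintegral.
pose A (k : 'I_N.+1) : set R := [set` `[x (lo k), x (hi k)[].
pose g (k : 'I_N.+1) := (EFin \o horner (F k)^`()) \_ (A k).
have AD k : A k `<=` mesh_domain x.
  move=> t; rewrite /A /mesh_domain /= !in_itv/= => /andP[kt /ltW tk].
  by rewrite (le_trans _ kt) ?(le_trans tk) ?(mesh_le hx)// -ltnS ltn_ord.
have mD : measurable (mesh_domain x : set (measurableTypeR R)) by exact: measurable_itv.
have mA k : measurable (A k : set (measurableTypeR R)) by exact: measurable_itv.
have intA k : mu.-integrable (A k) (EFin \o horner (F k)^`()).
  apply: integrableS (integrable_horner (x (lo k)) (x (hi k)) (F k)^`());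
    [exact: measurable_itv|exact: mA|].
  by rewrite /A => t; rewrite /= !in_itv/= => /andP[-> /ltW->].
have intg k : mu.-integrable (mesh_domain x) (g k).
  apply: (integrableS measurableT) => //.
  exact: (integrable_mkcond _ (mA k)).1 (intA k).
have -> : (\int[mu]_(t in mesh_domain x) (broken_fun x (broken_grad F) t)%:E =
           \int[mu]_(t in mesh_domain x) \sum_(k < N.+1) g k t)%E.
  apply: eq_integral => t _; rewrite -sumEFin; apply: eq_bigr => k _.
  rewrite /g patchE /A; case: ifPn => h; case: ifPn => //.
    by rewrite notin_setE /= in_itv/= h.
  by rewrite inE /= in_itv/= (negbTE h).
rewrite integral_sum//.
have intgk k : (\int[mu]_(t in mesh_domain x) g k t =
    ((F k).[x (hi k)] - (F k).[x (lo k)])%:E)%E.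
  (* Adding the right endpoint, a null set, gives the closed interval needed for the fundamental
     theorem of calculus. *)
  rewrite -integral_mkcondr setIidr// integral_itv_bndo_bndc; last first.
    exact: measurable_int (intA k).
  by apply: integral_horner_deriv; apply: hx; rewrite /= /bump leq0n.
by under eq_bigr do rewrite intgk; rewrite sumEFin.
Qed.

End BrokenIntegral.

(** * The lifting of a jump at an interior edge *)

Section EdgeLifting.
Context (R : realType) (N : nat) (x : 'I_N.+2 -> R) (p : nat) (e : 'I_N).
Hypothesis hx : is_mesh x.

Let lt_elt (k : 'I_N.+1) : x (lo k) < x (hi k).
Proof. by apply: hx; rewrite /= /bump leq0n. Qed.

Let lo_hi : lo (hi e) = hi (lo e).
Proof. exact: val_inj. Qed.

Let hi_neq_lo : hi e != lo e.
Proof. by rewrite -val_eqE /= /bump leq0n add1n gtn_eqF. Qed.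

(* Swapping the endpoints in the kernel reproduces the left endpoint value, with
   a sign coming from the orientation of the integral. *)
Definition edge_lifting (j : R) : broken R N := fun k =>
  if k == lo e then - (j / 2) *: endpoint_kernel p (x (lo k)) (x (hi k))
  else if k == hi e then (j / 2) *: endpoint_kernel p (x (hi k)) (x (lo k))
  else 0.

Lemma edge_lifting_is_lifting (j : R) : is_lifting x p e j (edge_lifting j).
Proof.
split=> [k|phi dphi].
  rewrite /edge_lifting; case: eqP => _; last case: eqP => _;
    by rewrite ?size_poly0// (leq_trans (size_scale_leq _ _))// size_endpoint_kernel.
(* [c k] is the share of element [k] in [- j * edge_avg x e phi]. *)
pose c k := if k == lo e then - (j / 2) * (phi k).[x (hi k)]
            else if k == hi e then - (j / 2) * (phi k).[x (lo k)] else 0.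
have prim k : exists F : {poly R}, F^`() = edge_lifting j k * phi k /\
    F.[x (hi k)] - F.[x (lo k)] = c k.
  rewrite /edge_lifting /c; case: eqP => _; last case: eqP => _.
  - have [|F F' dF] := @endpoint_kernel_reproduces _ p (x (lo k)) (x (hi k)) _ _ (dphi k).
      by rewrite lt_eqF.
    exists (- (j / 2) *: F); rewrite derivZ F' scalerAl; split=> //.
    by rewrite !hornerZ -mulrBr dF.
  - have [|F F' dF] := @endpoint_kernel_reproduces _ p (x (hi k)) (x (lo k)) _ _ (dphi k).
      by rewrite gt_eqF.
    exists (j / 2 *: F); rewrite derivZ F' scalerAl; split=> //.
    by rewrite !hornerZ -mulrBr -opprB dF mulrN mulNr.
  - by exists 0; rewrite deriv0 mul0r !horner0 subrr.
have [F FP] := choice prim.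
under eq_Rintegral do rewrite broken_funM//.
have -> : (fun k => edge_lifting j k * phi k) = broken_grad F.
  by apply/funext => k; rewrite /broken_grad (FP k).1.
rewrite integral_broken_fun//.
under eq_bigr do rewrite (FP _).2.
rewrite (bigD1 (lo e))//= (bigD1 (hi e))//= big1 => [|k /andP[klo khi]]; last first.
  by rewrite /c (negbTE klo) (negbTE khi).
rewrite /c eqxx (negbTE hi_neq_lo) eqxx lo_hi /edge_avg /trace_minus /trace_plus /edge_point.
by field.
Qed.

(** An element of length [2 * J] contributes [(p + 1)^2 / (2 * J)], halved once by the weight
    [j / 2] and once by the average; this is the source of the 8. *)
Lemma edge_avg_edge_lifting (j : R) :
  let J := elt_jacobian x (lo e) in let J' := elt_jacobian x (hi e) in
  edge_avg x e (edge_lifting j) = - j * ((p%:R + 1) ^+ 2 * (J + J') / (8 * J * J')).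
Proof.
move=> J J'; rewrite /edge_avg /trace_minus /trace_plus /edge_lifting.
rewrite eqxx (negbTE hi_neq_lo) eqxx lo_hi /edge_point.
have scaleE (c a b t : R) :
  (c *: endpoint_kernel p a b).[t] = c * (endpoint_kernel p a b).[t] by rewrite hornerZ.
have := lt_elt (lo e); have := lt_elt (hi e); rewrite lo_hi => h1 h2.
rewrite !scaleE !endpoint_kernel_diag ?(lt_eqF h2) ?(gt_eqF h1)//.
rewrite -natr1 /J /J' /elt_jacobian lo_hi.
field.
by rewrite !subr_eq0 (gt_eqF h1) (gt_eqF h2) (lt_eqF h1).
Qed.

(* Testing any lifting of [j] against the explicit lifting of 1, and conversely,
   evaluates the same symmetric integral. *)
Lemma edge_avg_is_lifting (j : R) (r : broken R N) : is_lifting x p e j r ->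
  edge_avg x e r = j * edge_avg x e (edge_lifting 1).
Proof.
move=> [dr Hr]; have [dL HL] := edge_lifting_is_lifting 1.
have := HL r dr; under eq_Rintegral do rewrite mulrC.
by rewrite (Hr _ dL) mulN1r mulNr => /oppr_inj.
Qed.

Lemma edge_avg_lifting (j : R) :
  let J := elt_jacobian x (lo e) in let J' := elt_jacobian x (hi e) in
  edge_avg x e (lifting x p e j) =
    - j * ((p%:R + 1) ^+ 2 * (J + J') / (8 * J * J')).
Proof.
(* The explicit lifting witnesses existence, so the choice in [lifting] does not fall back to its
   default. *)
move=> J J'; have H : is_lifting x p e j (lifting x p e j).
  exact: (xgetPex (fun=> 0) (ex_intro _ _ (edge_lifting_is_lifting j))).
by rewrite (edge_avg_is_lifting H) edge_avg_edge_lifting mulrA mulrN1.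
Qed.

End EdgeLifting.

Theorem theorem5p1 (R : realType) (N : nat) (x : 'I_N.+2 -> R)
    (hx : is_mesh x) (p : nat) (hp : (1 <= p)%N) (e : 'I_N) (s tau : R) :
  (forall u : broken R N, broken_degree_le p u ->
     BR2_flux x p e s u = IP_flux x e tau u)
  <->
  s = (8 * elt_jacobian x (lo e) * elt_jacobian x (hi e))
      / ((elt_jacobian x (lo e) + elt_jacobian x (hi e)) * (p%:R + 1) ^+ 2) * tau.
Proof.
have J_gt0 k : 0 < elt_jacobian x k.
  by rewrite divr_gt0// subr_gt0; apply: hx; rewrite /= /bump leq0n.
set J := elt_jacobian x (lo e); set J' := elt_jacobian x (hi e).
have J0 : J != 0 by rewrite gt_eqF// J_gt0.
have J'0 : J' != 0 by rewrite gt_eqF// J_gt0.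
have JJ'0 : J + J' != 0 by rewrite gt_eqF// addr_gt0 ?J_gt0.
have p0 : (p%:R + 1 : R) != 0 by rewrite natr1 pnatr_eq0.
(* Minus the edge average of the lifting of a unit jump. *)
pose c := (p%:R + 1) ^+ 2 * (J + J') / (8 * J * J').
have sE : s = 8 * J * J' / ((J + J') * (p%:R + 1) ^+ 2) * tau <-> s * c = tau.
  split=> [->|<-]; rewrite /c; field; by rewrite ?J0 ?J'0 ?JJ'0 ?p0.
rewrite sE; split=> [flux_eq|sc u _]; last first.
  by rewrite /BR2_flux /IP_flux edge_avg_lifting// -/J -/J' -/c -sc; congr (_, _); ring.
pose u : broken R N := fun k => (k == lo e)%:R.
have du : broken_degree_le p u.
  by move=> k; rewrite /u; case: (k == _); rewrite ?size_poly1 ?size_poly0.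
have ju : edge_jump x e u = 1.
  rewrite /edge_jump /trace_minus /trace_plus /u eqxx -val_eqE /= /bump leq0n add1n.
  by rewrite gtn_eqF// hornerC horner0 subr0.
have := congr1 snd (flux_eq u du).
rewrite /= edge_avg_lifting// -/J -/J' -/c ju => /addrI.
by rewrite mulN1r mulrN mulr1 => /oppr_inj.
Qed.
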